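(* Let $0<a<1$ and let $g\in H^2(\mathbb{D})$ be such that $g'$ is $\mathbf{EB}$. Suppose that either (A) the sequence $(g(1-a^n))_{n\in\mathbb{N}}$ converges to a number $L\neq 0$, or (C) the sequence $(g(1-a^n))_{n\in\mathbb{N}}$ does not converge. Then $K_g$ is a minimal invariant subspace of $C_{\phi_a}$ if and only if $\dim K_g=1$.
   Context: $H^2=H^2(\mathbb{D})$ is the Hardy-Hilbert space of holomorphic functions on the open unit disk $\mathbb{D}$. For $a\in(0,1)$, $\phi_a(z)=az+1-a$, a holomorphic self-map of $\mathbb{D}$, and $C_{\phi_a}f=f\circ\phi_a$ is the (bounded) composition operator on $H^2$. For $f\in H^2$, $K_f:=\overline{\mathrm{span}\{f,C_{\phi_a}f,C_{\phi_a}^2f,\ldots\}}$ (closure in $H^2$). A minimal invariant subspace of $C_{\phi_a}$ is a nonzero closed invariant subspace whose only closed $C_{\phi_a}$-invariant subspaces are $\{0\}$ and itself. For $n\in\mathbb{N}$ let $D_n:=\phi_{a^n}(\mathbb{D})=a^n\mathbb{D}+1-a^n$, the disk with center $1-a^n$ and radius $a^n$. A holomorphic function on $\mathbb{D}$ is called eventually bounded at $1$ ($\mathbf{EB}$) if it is bounded on $D_n$ for some $n\in\mathbb{N}$. *)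

(* Defs.v *)
From Stdlib Require Import Reals.
From Coquelicot Require Import Coquelicot.
Open Scope C_scope.

(** A function on the open unit disk is represented by a total function
    [C -> C] whose values outside the disk are irrelevant: two such functions
    denote the same element when they agree on the disk. *)

Definition disk (z : C) : Prop := (Cmod z < 1)%R.

Definition eq_on_disk (f h : C -> C) : Prop := forall z, disk z -> f z = h z.

Definition zero_fun : C -> C := fun _ => 0.

Definition holomorphic_on_disk (f : C -> C) : Prop :=
  forall z, disk z -> ex_derive f z.

(** The Hardy-Hilbert space consists of the functions
    [f(z) = sum_n u_n z^n] on the disk with [sum_n |u_n|^2 < oo], and
    [||f||^2 = sum_n |u_n|^2].  Such an [f] is holomorphic and [u] is unique,
    so [is_H2_norm f] holds of at most one real. *)

Definition taylor_on_disk (u : nat -> C) (f : C -> C) : Prop :=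
  forall z, disk z -> is_series (fun n => u n * z ^ n) (f z).

Definition is_H2_norm (f : C -> C) (N : R) : Prop :=
  (0 <= N)%R /\
  exists u : nat -> C,
    taylor_on_disk u f /\
    is_series (fun n => (Cmod (u n) ^ 2)%R) (N ^ 2)%R.

Definition H2 (f : C -> C) : Prop := exists N : R, is_H2_norm f N.

Definition H2_closure (S : (C -> C) -> Prop) (f : C -> C) : Prop :=
  H2 f /\
  forall eps : R, (0 < eps)%R ->
    exists h, S h /\
      exists N : R, is_H2_norm (fun z => f z - h z) N /\ (N < eps)%R.

(** The last field also makes [M] invariant under equality on the disk. *)
Record closed_subspace (M : (C -> C) -> Prop) : Prop := {
  csub_H2 : forall f, M f -> H2 f;
  csub_zero : M zero_fun;
  csub_add : forall f h, M f -> M h -> M (fun z => f z + h z);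
  csub_scal : forall (c : C) f, M f -> M (fun z => c * f z);
  csub_closed : forall f, H2_closure M f -> M f
}.

Fixpoint lin_comb (c : nat -> C) (e : nat -> C -> C) (d : nat) (z : C) : C :=
  match d with
  | O => 0
  | S k => lin_comb c e k z + c k * e k z
  end.

Definition span (e : nat -> C -> C) (f : C -> C) : Prop :=
  exists (d : nat) (c : nat -> C), eq_on_disk f (lin_comb c e d).

Definition has_dim (M : (C -> C) -> Prop) (d : nat) : Prop :=
  exists e : nat -> C -> C,
    (forall i, (i < d)%nat -> M (e i)) /\
    (forall c, eq_on_disk (lin_comb c e d) zero_fun ->
       forall i, (i < d)%nat -> c i = 0) /\
    (forall f, M f -> exists c, eq_on_disk f (lin_comb c e d)).

Definition phi (a : R) (z : C) : C := RtoC a * z + 1 - RtoC a.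

Definition comp_op (a : R) (f : C -> C) : C -> C := fun z => f (phi a z).

Definition invariant (a : R) (M : (C -> C) -> Prop) : Prop :=
  forall f, M f -> M (comp_op a f).

Definition orbit_space (a : R) (f : C -> C) : (C -> C) -> Prop :=
  H2_closure (span (fun n => Nat.iter n (comp_op a) f)).

Definition minimal_invariant_subspace (a : R) (M : (C -> C) -> Prop) : Prop :=
  closed_subspace M /\ invariant a M /\
  (exists f, M f /\ ~ eq_on_disk f zero_fun) /\
  (forall N : (C -> C) -> Prop,
     closed_subspace N -> invariant a N -> (forall f, N f -> M f) ->
     (forall f, N f -> eq_on_disk f zero_fun) \/ (forall f, M f -> N f)).

Definition disk_n (a : R) (n : nat) (z : C) : Prop :=
  exists w, disk w /\ z = phi (a ^ n)%R w.

Definition eventually_bounded (a : R) (f : C -> C) : Prop :=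
  holomorphic_on_disk f /\
  exists (n : nat) (B : R), forall z, disk_n a n z -> (Cmod (f z) <= B)%R.

Definition seq_converges_to (s : nat -> C) (L : C) : Prop :=
  filterlim s eventually (locally L).

(* Main.v *)
Require Import Defs.
From Stdlib Require Import Reals Lra Lia Classical ClassicalEpsilon FunctionalExtensionality PropExtensionality.
From Coquelicot Require Import Coquelicot.
Open Scope C_scope.

(** Why the theorem is true.  The disk [D_n] is convex, so a bound on [g'] over
    [D_n] makes [g] Lipschitz there ([mean_value_segment]).  Since
    [phi_(a^m)] maps the unit disk onto [D_m], a disk of radius [a^m] that lies
    in [D_n] for [m >= n], the iterate [g o phi_(a^m)] differs from the value
    [g (1 - a^m)] by at most a constant times [a^m], uniformly on the unit disk
    ([eventually_bounded_derivative_lipschitz]).  In particular the sequence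
    [g (1 - a^m)] is Cauchy ([boundary_values_converge]), which rules out the
    second alternative and leaves a limit [L <> 0]; and the orbit of [g]
    converges to the constant [L] uniformly on the disk.

    A function bounded by [M] on the disk has [H^2] norm at most [M]
    ([bounded_H2_norm]), so the convergence holds in [H^2] and [K_g] contains
    the constants ([constants_in_orbit_space]).  The constants form a closed
    invariant subspace, so if [K_g] is minimal it equals the constants, which
    have dimension one.  Conversely, a one-dimensional [K_g] that contains the
    constants is the space of constants, and a one-dimensional space is
    minimal.

    Two analytic facts are built from power series alone.  That
    [g o phi_(a^m)] has a Taylor expansion follows by expanding
    [u_n (a z + b)^n] and exchanging the order of summation
    ([taylor_affine_comp]).  The bound of the [H^2] norm by the supremum is
    Parseval's identity for polynomials, with the average over a circle
    replaced by the average over roots of unity ([discrete_parseval]). *)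

(** * Sums and limits of complex sequences *)

(* Sums in an abstract monoid leave equations at a type that is only
   convertible to [C]; [ring] needs to see [C] itself. *)
Ltac eq_at_C := match goal with |- ?x = ?y => change (@eq C x y) end.
Ltac ring_at_C := first [ring | eq_at_C; ring].

Lemma C_limit_eps (s : nat -> C) (l : C) :
  filterlim s eventually (locally l) <->
  (forall eps : R, (0 < eps)%R -> exists N, forall n, (N <= n)%nat ->
     (Cmod (s n - l) < eps)%R).
Proof.
  rewrite (filterlim_locally_ball_norm (K := C_AbsRing) (U := C_NormedModule)).
  split.
  - intros H eps Heps. exact (H (mkposreal eps Heps)).
  - intros H eps. exact (H eps (cond_pos eps)).
Qed.

Lemma C_limit_le (s : nat -> C) (l c : C) (B : R) (N : nat) :
  filterlim s eventually (locally l) ->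
  (forall n, (N <= n)%nat -> (Cmod (s n - c) <= B)%R) ->
  (Cmod (l - c) <= B)%R.
Proof.
  intros Hl HB. apply le_epsilon. intros eps Heps.
  destruct (proj1 (C_limit_eps s l) Hl eps Heps) as [N' HN'].
  pose (n := Nat.max N N').
  assert (H1 := HN' n (Nat.le_max_r _ _)).
  assert (H2 := HB n (Nat.le_max_l _ _)).
  replace (l - c) with ((s n - c) + - (s n - l)) by ring.
  eapply Rle_trans; [apply Cmod_triangle|]. rewrite Cmod_opp. lra.
Qed.

Lemma C_sum_Sn (u : nat -> C) (n : nat) :
  sum_n u (S n) = sum_n u n + u (S n).
Proof. exact (sum_Sn u n). Qed.

Lemma R_sum_Sn (u : nat -> R) (n : nat) :
  sum_n u (S n) = (sum_n u n + u (S n))%R.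
Proof. exact (sum_Sn u n). Qed.

Lemma R_sum_nonneg (s : nat -> R) (n : nat) :
  (forall k, 0 <= s k)%R -> (0 <= sum_n s n)%R.
Proof.
  intros Hs. induction n as [|n IH].
  - rewrite sum_O. apply Hs.
  - rewrite R_sum_Sn. generalize (Hs (S n)). lra.
Qed.

Lemma R_partial_sum_le (s : nat -> R) (l : R) (n : nat) :
  (forall k, 0 <= s k)%R -> is_series s l -> (sum_n s n <= l)%R.
Proof.
  intros Hs Hl.
  apply (is_lim_seq_incr_compare (sum_n s) l).
  - exact Hl.
  - intros k. rewrite R_sum_Sn. generalize (Hs (S k)). lra.
Qed.

Lemma R_series_eps (s : nat -> R) (l : R) :
  is_series s l -> forall eps : R, (0 < eps)%R ->
  exists N, forall n, (N <= n)%nat -> (Rabs (sum_n s n - l) < eps)%R.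
Proof.
  intros Hl eps Heps.
  exact (proj1 (filterlim_locally_ball_norm (K := R_AbsRing)
    (U := R_NormedModule) (F := eventually) (sum_n s) l) Hl (mkposreal eps Heps)).
Qed.

Lemma Cmod_sum_le (u : nat -> C) (n : nat) :
  (Cmod (sum_n u n) <= sum_n (fun k => Cmod (u k)) n)%R.
Proof. exact (norm_sum_n_m u 0 n). Qed.

(** The error of a partial sum of [u] is controlled by the remainder of a
    majorant, a form that keeps the estimate uniform over all series with the
    same majorant. *)
Lemma C_series_tail (u : nat -> C) (s : nat -> R) (l : C) (t : R) (K : nat) :
  (forall n, Cmod (u n) <= s n)%R ->
  is_series s t -> is_series u l ->
  (Cmod (l - sum_n u K) <= t - sum_n s K)%R.
Proof.
  intros Hus Ht Hl.
  assert (Hs : forall n, (0 <= s n)%R)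
    by (intros n; eapply Rle_trans; [apply Cmod_ge_0|apply Hus]).
  apply (C_limit_le (sum_n u) l _ _ K Hl).
  intros n Hn.
  apply Rle_trans with (sum_n s n - sum_n s K)%R.
  - induction Hn as [|n Hn IH].
    + rewrite Rminus_diag. apply Req_le.
      rewrite <- Cmod_0. f_equal. ring.
    + rewrite C_sum_Sn, R_sum_Sn.
      replace (sum_n u n + u (S n) - sum_n u K)
        with ((sum_n u n - sum_n u K) + u (S n)) by ring.
      eapply Rle_trans; [apply Cmod_triangle|].
      generalize (Hus (S n)). lra.
  - generalize (R_partial_sum_le s t n Hs Ht). lra.
Qed.

Lemma C_series_finite_sum (T : nat -> nat -> C) (col : nat -> C) (K : nat) :
  (forall k, is_series (fun n => T n k) (col k)) ->
  is_series (fun n => sum_n (T n) K) (sum_n col K).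
Proof.
  intros H. induction K as [|K IH].
  - rewrite sum_O. eapply is_series_ext; [|apply H].
    intros n. now rewrite sum_O.
  - rewrite sum_Sn.
    eapply is_series_ext; [|exact (is_series_plus _ _ _ _ IH (H (S K)))].
    intros n. now rewrite sum_Sn.
Qed.

Lemma sum_n_stationary (u : nat -> C) (n K : nat) :
  (forall k, (n < k)%nat -> u k = 0) -> (n <= K)%nat -> sum_n u K = sum_n u n.
Proof.
  intros Hu. induction 1 as [|K HK IH]; [reflexivity|].
  rewrite C_sum_Sn, IH, Hu by lia. ring_at_C.
Qed.

(** Summing a lower triangular array by rows or by columns.  The difference
    between the first [K] columns and all the rows only involves rows beyond
    [K], since each earlier row is supported in these columns; those rows are
    dominated by the remainder of [s], twice because both the full row and its
    truncation occur. *)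
Lemma triangular_fubini (T : nat -> nat -> C) (s : nat -> R) (col : nat -> C)
  (l : C) :
  (forall n k, (n < k)%nat -> T n k = 0) ->
  (forall n K, (Cmod (sum_n (T n) K) <= s n)%R) ->
  ex_series s ->
  (forall k, is_series (fun n => T n k) (col k)) ->
  is_series (fun n => sum_n (T n) n) l ->
  is_series col l.
Proof.
  intros HT Hs [t Ht] Hcol Hl.
  apply C_limit_eps. intros eps Heps.
  destruct (R_series_eps s t Ht (eps / 2)) as [N HN]; [lra|].
  exists N. intros K HK.
  assert (Ht2 : is_series (fun n => (2 * s n)%R) (2 * t)%R)
    by exact (is_series_scal_l 2%R s t Ht).
  pose (d := fun n => sum_n (T n) K - sum_n (T n) n).
  assert (Hd : is_series d (sum_n col K - l))
    by exact (is_series_minus _ _ _ _ (C_series_finite_sum T col K Hcol) Hl).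
  assert (Hd0 : forall n, (n <= K)%nat -> d n = 0).
  { intros n Hn. unfold d. rewrite (sum_n_stationary (T n) n K) by auto.
    ring. }
  assert (Hsum0 : forall m, (m <= K)%nat -> sum_n d m = RtoC 0).
  { induction m as [|m IH]; intros Hm.
    - rewrite sum_O. now apply Hd0.
    - rewrite C_sum_Sn, IH, Hd0 by lia. ring_at_C. }
  assert (Hds : forall n, (Cmod (d n) <= 2 * s n)%R).
  { intros n. unfold d, Cminus.
    eapply Rle_trans; [apply Cmod_triangle|]. rewrite Cmod_opp.
    generalize (Hs n K) (Hs n n). lra. }
  assert (Htail := C_series_tail d _ _ _ K Hds Ht2 Hd).
  rewrite (Hsum0 K (le_n K)) in Htail.
  assert (H2s : sum_n (fun n => (2 * s n)%R) K = (2 * sum_n s K)%R)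
    by exact (sum_n_mult_l (K := R_AbsRing) 2%R s K).
  rewrite H2s in Htail.
  replace (sum_n col K - l - 0) with (sum_n col K - l) in Htail by ring.
  eapply Rle_lt_trans; [exact Htail|].
  specialize (HN K HK). apply Rabs_def2 in HN. lra.
Qed.

(** The terms of the series at a point [p] between [r] and [1] are bounded, so
    at [r] the series is dominated by a geometric one of ratio [r / p]. *)
Lemma taylor_abs_summable (u : nat -> C) (f : C -> C) (r : R) :
  taylor_on_disk u f -> (0 <= r < 1)%R ->
  ex_series (fun n => (Cmod (u n) * r ^ n)%R).
Proof.
  intros Hu Hr.
  pose (p := ((1 + r) / 2)%R).
  assert (Hp : (r < p < 1 /\ 0 < p)%R) by (unfold p; lra).
  assert (Hd : disk (RtoC p)) by (unfold disk; rewrite Cmod_R, Rabs_pos_eq; lra).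
  destruct (filterlim_bounded (K := C_AbsRing) (V := C_NormedModule) _
    (ex_intro _ _ (Hu _ Hd))) as [M HM].
  change (forall n, (Cmod (sum_n (fun n => (u n * RtoC p ^ n)%C) n) <= M)%R) in HM.
  assert (Hterm : forall n, (Cmod (u n) * p ^ n <= 2 * M)%R).
  { intros n.
    replace (Cmod (u n) * p ^ n)%R with (Cmod (u n * RtoC p ^ n)).
    2:{ rewrite Cmod_mult, Cmod_pow, Cmod_R, Rabs_pos_eq; lra. }
    assert (HM0 := HM 0%nat). destruct n as [|n].
    - rewrite sum_O in HM0.
      generalize (Cmod_ge_0 (u 0%nat * RtoC p ^ 0)). lra.
    - assert (H1 := HM n). assert (H2 := HM (S n)).
      rewrite C_sum_Sn in H2.
      set (t := sum_n _ n) in *. set (x := u (S n) * RtoC p ^ S n) in *.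
      replace x with ((t + x) + - t) by ring.
      eapply Rle_trans; [apply Cmod_triangle|]. rewrite Cmod_opp. lra. }
  apply (ex_series_le (K := R_AbsRing) (V := R_CompleteNormedModule) _
    (fun n => (2 * M * (r / p) ^ n)%R)).
  - intros n. change (Rabs (Cmod (u n) * r ^ n) <= 2 * M * (r / p) ^ n)%R.
    rewrite Rabs_pos_eq.
    2:{ apply Rmult_le_pos; [apply Cmod_ge_0|apply pow_le; lra]. }
    replace (Cmod (u n) * r ^ n)%R with ((Cmod (u n) * p ^ n) * (r / p) ^ n)%R.
    + apply Rmult_le_compat_r; [|apply Hterm].
      apply pow_le, Rdiv_le_0_compat; lra.
    + rewrite Rmult_assoc, <- Rpow_mult_distr. do 2 f_equal. field. lra.
  - apply (ex_series_scal_l (K := R_AbsRing) (V := R_NormedModule) (2 * M)%R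
      (fun n => ((r / p) ^ n)%R)).
    apply ex_series_geom. rewrite Rabs_pos_eq.
    + apply Rmult_lt_reg_r with p; [lra|]. field_simplify; lra.
    + apply Rdiv_le_0_compat; lra.
Qed.

(** * Taylor series after an affine change of variable *)

(** The coefficient of [z^k] in [(a z + b)^n].  Pascal's recursion replaces the
    closed form with binomials: it is what the inductions below use, and it
    needs no truncated subtraction. *)
Fixpoint affine_pow_coef (a b : R) (n k : nat) : R :=
  match n with
  | O => match k with O => 1 | S _ => 0 end
  | S n' => b * affine_pow_coef a b n' k
            + match k with O => 0 | S k' => a * affine_pow_coef a b n' k' end
  end%R.

Definition affine_pow_term (a b : R) (z : C) (n k : nat) : C :=
  RtoC (affine_pow_coef a b n k) * z ^ k.

Lemma affine_pow_coef_triangular (a b : R) (n k : nat) :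
  (n < k)%nat -> affine_pow_coef a b n k = 0%R.
Proof.
  revert k. induction n as [|n IH]; intros [|k] Hk; try lia; simpl; trivial.
  rewrite (IH k), (IH (S k)) by lia. ring.
Qed.

Lemma affine_pow_sum_0 (a b : R) (z : C) (K : nat) :
  sum_n (affine_pow_term a b z 0) K = RtoC 1.
Proof.
  induction K as [|K IH].
  - rewrite sum_O. unfold affine_pow_term. simpl. ring.
  - rewrite C_sum_Sn, IH. unfold affine_pow_term. simpl. ring.
Qed.

Lemma affine_pow_sum_step (a b : R) (z : C) (n K : nat) :
  sum_n (affine_pow_term a b z (S n)) (S K) =
  RtoC b * sum_n (affine_pow_term a b z n) (S K)
  + RtoC a * z * sum_n (affine_pow_term a b z n) K.
Proof.
  assert (Hterm : forall k, affine_pow_term a b z (S n) (S k) =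
    RtoC b * affine_pow_term a b z n (S k)
    + RtoC a * z * affine_pow_term a b z n k).
  { intros k. unfold affine_pow_term. cbn [affine_pow_coef].
    rewrite RtoC_plus, !RtoC_mult, Cpow_S. ring. }
  induction K as [|K IH].
  - rewrite !C_sum_Sn, !sum_O, Hterm. unfold affine_pow_term at 1.
    cbn [affine_pow_coef]. rewrite RtoC_plus, RtoC_mult.
    unfold affine_pow_term. change (z ^ 0) with (RtoC 1). ring_at_C.
  - rewrite C_sum_Sn, IH, Hterm.
    rewrite (C_sum_Sn _ (S K)), (C_sum_Sn _ K). ring_at_C.
Qed.

Lemma affine_pow_expand (a b : R) (z : C) (n : nat) :
  sum_n (affine_pow_term a b z n) n = (RtoC a * z + RtoC b) ^ n.
Proof.
  induction n as [|n IH]; [apply affine_pow_sum_0|].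
  rewrite affine_pow_sum_step, C_sum_Sn, IH.
  unfold affine_pow_term. rewrite affine_pow_coef_triangular by lia.
  rewrite (Cpow_S (RtoC a * z + RtoC b)). ring_at_C.
Qed.

(** Majorant of the row [n] that does not depend on where the row is cut.
    Induction on [n] through the recursion gives it directly, without
    comparing with the expansion at [Cmod z]. *)
Lemma affine_pow_sum_bound (a b : R) (z : C) (n K : nat) :
  (0 <= a)%R -> (0 <= b)%R ->
  (Cmod (sum_n (affine_pow_term a b z n) K) <= (a * Cmod z + b) ^ n)%R.
Proof.
  intros Ha Hb. assert (Hz := Cmod_ge_0 z).
  assert (Haz : (0 <= a * Cmod z)%R) by now apply Rmult_le_pos.
  revert K. induction n as [|n IH]; intros K.
  - rewrite affine_pow_sum_0, Cmod_1. simpl. lra.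
  - assert (Hstep : forall p q : C, (Cmod p <= (a * Cmod z + b) ^ n)%R ->
      (Cmod q <= (a * Cmod z + b) ^ n)%R ->
      (Cmod (RtoC b * p + RtoC a * z * q) <= (a * Cmod z + b) ^ S n)%R).
    { intros p q Hp Hq. eapply Rle_trans; [apply Cmod_triangle|].
      rewrite !Cmod_mult, !Cmod_R, !Rabs_pos_eq by assumption. simpl.
      assert (H1 := Rmult_le_compat_l _ _ _ Hb Hp).
      assert (H2 := Rmult_le_compat_l _ _ _ Haz Hq). lra. }
    destruct K as [|K].
    + replace (sum_n (affine_pow_term a b z (S n)) 0)
        with (RtoC b * sum_n (affine_pow_term a b z n) 0 + RtoC a * z * 0).
      * apply Hstep; [apply IH|]. rewrite Cmod_0. apply pow_le. lra.
      * rewrite !sum_O. unfold affine_pow_term. cbn [affine_pow_coef].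
        rewrite RtoC_plus, RtoC_mult. ring.
    + rewrite affine_pow_sum_step. now apply Hstep.
Qed.

Lemma affine_pow_term_bound (a b : R) (z : C) (n k : nat) :
  (0 <= a)%R -> (0 <= b)%R ->
  (Cmod (affine_pow_term a b z n k) <= 2 * (a * Cmod z + b) ^ n)%R.
Proof.
  intros Ha Hb.
  assert (Hk := affine_pow_sum_bound a b z n k Ha Hb). destruct k as [|k].
  - rewrite sum_O in Hk.
    generalize (Cmod_ge_0 (affine_pow_term a b z n 0)). lra.
  - assert (Hk' := affine_pow_sum_bound a b z n k Ha Hb).
    rewrite C_sum_Sn in Hk.
    set (t := sum_n _ k) in *. set (x := affine_pow_term a b z n (S k)) in *.
    replace x with ((t + x) + - t) by ring.
    eapply Rle_trans; [apply Cmod_triangle|]. rewrite Cmod_opp. lra.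
Qed.

Lemma affine_contraction (a b r : R) :
  (0 < a)%R -> (0 <= b)%R -> (a + b <= 1)%R -> (0 <= r < 1)%R ->
  (0 <= a * r + b < 1)%R.
Proof. intros; nra. Qed.

Lemma C_sum_mult_l (c : C) (u : nat -> C) (n : nat) :
  sum_n (fun k => c * u k) n = c * sum_n u n.
Proof. exact (sum_n_mult_l (K := C_Ring) c u n). Qed.

(** Expand each [u_n (a z + b)^n] and collect the powers of [z]; the exchange is
    legitimate because [a |z| + b < 1], where the series of [u] converges
    absolutely. *)
Lemma taylor_affine_comp (u : nat -> C) (f : C -> C) (a b : R) :
  taylor_on_disk u f -> (0 < a)%R -> (0 <= b)%R -> (a + b <= 1)%R ->
  exists v, taylor_on_disk v (fun z => f (RtoC a * z + RtoC b)).
Proof.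
  intros Hu Ha Hb Hab.
  assert (Ha0 : (0 <= a)%R) by lra.
  (* The columns are independent of [z]; their convergence comes from the row
     bound at the single point 1/2, at the price of a factor [2 ^ k]. *)
  assert (Hcol : forall k, exists c : C,
    is_series (fun n => u n * RtoC (affine_pow_coef a b n k)) c).
  { intros k.
    apply (ex_series_le (K := C_AbsRing) (V := C_CompleteNormedModule) _
      (fun n => ((2 * 2 ^ k) * (Cmod (u n) * (a * (1 / 2) + b) ^ n))%R)).
    - intros n.
      change (Cmod (u n * RtoC (affine_pow_coef a b n k))
              <= 2 * 2 ^ k * (Cmod (u n) * (a * (1 / 2) + b) ^ n))%R.
      assert (Hterm := affine_pow_term_bound a b (RtoC (1 / 2)) n k Ha0 Hb).
      unfold affine_pow_term in Hterm.
      rewrite Cmod_mult, Cmod_pow, !Cmod_R in Hterm.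
      rewrite (Rabs_pos_eq (1 / 2)) in Hterm by lra.
      rewrite Cmod_mult, Cmod_R.
      set (x := Rabs _) in *. set (y := ((a * (1 / 2) + b) ^ n)%R) in *.
      assert (Hx : (x <= 2 * 2 ^ k * y)%R).
      { apply (Rmult_le_compat_r (2 ^ k)) in Hterm; [|apply pow_le; lra].
        rewrite Rmult_assoc, <- Rpow_mult_distr in Hterm.
        replace (1 / 2 * 2)%R with 1%R in Hterm by lra.
        rewrite pow1 in Hterm. lra. }
      assert (Hx2 := Rmult_le_compat_l _ _ _ (Cmod_ge_0 (u n)) Hx). lra.
    - apply (ex_series_scal_l (K := R_AbsRing) (V := R_NormedModule) (2 * 2 ^ k)%R
        (fun n => (Cmod (u n) * (a * (1 / 2) + b) ^ n)%R)).
      apply (taylor_abs_summable u f); trivial.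
      apply affine_contraction; lra. }
  exists (fun k => proj1_sig (constructive_indefinite_description _ (Hcol k))).
  intros z Hz.
  assert (Hr : (0 <= a * Cmod z + b < 1)%R).
  { apply affine_contraction; trivial. split; [apply Cmod_ge_0|exact Hz]. }
  apply (triangular_fubini (fun n k => u n * affine_pow_term a b z n k)
    (fun n => (Cmod (u n) * (a * Cmod z + b) ^ n)%R)).
  - intros n k Hnk. unfold affine_pow_term.
    rewrite affine_pow_coef_triangular by exact Hnk. ring.
  - intros n K. rewrite C_sum_mult_l, Cmod_mult.
    apply Rmult_le_compat_l; [apply Cmod_ge_0|].
    now apply affine_pow_sum_bound.
  - now apply (taylor_abs_summable u f).
  - intros k. unfold affine_pow_term.
    destruct (constructive_indefinite_description _ (Hcol k)) as [c Hc]. simpl.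
    rewrite (Cmult_comm c).
    eapply is_series_ext; [|exact (is_series_scal_l (z ^ k) _ _ Hc)].
    intros n. change (z ^ k * (u n * RtoC (affine_pow_coef a b n k)) =
      u n * (RtoC (affine_pow_coef a b n k) * z ^ k)). ring.
  - assert (Hw : disk (RtoC a * z + RtoC b)).
    { unfold disk. eapply Rle_lt_trans; [apply Cmod_triangle|].
      rewrite Cmod_mult, !Cmod_R, !Rabs_pos_eq by lra. lra. }
    eapply is_series_ext; [|exact (Hu _ Hw)].
    intros n. cbv beta. now rewrite C_sum_mult_l, affine_pow_expand.
Qed.

(** * Parseval's identity over roots of unity *)

Definition root_of_unity (N : nat) : C :=
  (cos (2 * PI / INR N), sin (2 * PI / INR N))%R.

Lemma cis_pow (t : R) (n : nat) :
  ((cos t, sin t) : C) ^ n = (cos (INR n * t), sin (INR n * t)).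
Proof.
  induction n as [|n IH].
  - simpl. rewrite Rmult_0_l, cos_0, sin_0. reflexivity.
  - rewrite Cpow_S, IH, S_INR.
    replace ((INR n + 1) * t)%R with (t + INR n * t)%R by ring.
    rewrite cos_plus, sin_plus. unfold Cmult; simpl. f_equal; ring.
Qed.

Lemma root_of_unity_Cmod (N : nat) : Cmod (root_of_unity N) = 1%R.
Proof.
  unfold root_of_unity, Cmod; simpl fst; simpl snd.
  rewrite <- sqrt_1. f_equal. rewrite <- !Rsqr_pow2, Rplus_comm. apply sin2_cos2.
Qed.

Lemma root_of_unity_pow (N : nat) :
  (0 < N)%nat -> root_of_unity N ^ N = 1.
Proof.
  intros HN. unfold root_of_unity. rewrite cis_pow.
  replace (INR N * (2 * PI / INR N))%R with (2 * PI)%R.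
  - now rewrite cos_2PI, sin_2PI.
  - field. apply not_0_INR. lia.
Qed.

Lemma root_of_unity_primitive (N d : nat) :
  (0 < d < N)%nat -> root_of_unity N ^ d <> 1.
Proof.
  intros Hd Heq. unfold root_of_unity in Heq. rewrite cis_pow in Heq.
  assert (HN : (0 < INR d < INR N)%R)
    by (split; [apply lt_0_INR|apply lt_INR]; lia).
  set (t := (INR d * (2 * PI / INR N))%R) in Heq.
  (* [1 - cos t = 2 sin^2 (t/2)], and [t/2] lies strictly between 0 and pi. *)
  assert (Ht : (0 < t / 2 < PI)%R).
  { assert (HPI := PI_RGT_0).
    replace (t / 2)%R with (PI * (INR d / INR N))%R
      by (unfold t; field; lra).
    assert (H0 : (0 < INR d / INR N)%R) by (apply Rdiv_lt_0_compat; lra).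
    assert (H1 : (INR d / INR N < 1)%R).
    { apply Rmult_lt_reg_r with (INR N); [lra|]. field_simplify; lra. }
    nra. }
  assert (Hs := sin_gt_0 _ (proj1 Ht) (proj2 Ht)).
  assert (Hc : cos t = 1%R) by exact (f_equal fst Heq).
  replace t with (2 * (t / 2))%R in Hc by field.
  rewrite cos_2a_sin in Hc. nra.
Qed.

Lemma geometric_sum_root_of_unity (x : C) (K : nat) :
  x ^ S K = 1 -> x <> 1 -> sum_n (fun j => x ^ j) K = RtoC 0.
Proof.
  intros HxK Hx.
  assert (Hgeom : (x - 1) * sum_n (fun j => x ^ j) K = x ^ S K - 1).
  { clear. induction K as [|K IH].
    - rewrite sum_O. simpl. ring.
    - rewrite C_sum_Sn, Cmult_plus_distr_l, IH, (Cpow_S x (S K)). ring. }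
  rewrite HxK in Hgeom.
  assert (Hx1 : x - 1 <> 0).
  { intros H. apply Hx. replace x with (x - 1 + 1) by ring. rewrite H. ring. }
  replace (sum_n (fun j => x ^ j) K)
    with (/ (x - 1) * ((x - 1) * sum_n (fun j => x ^ j) K)).
  - rewrite Hgeom. eq_at_C. field. exact Hx1.
  - rewrite Cmult_assoc, Cinv_l by exact Hx1. apply Cmult_1_l.
Qed.

Definition poly_eval (c : nat -> C) (n : nat) (x : C) : C :=
  sum_n (fun k => c k * x ^ k) n.

(** With [w] the root of unity, the conjugate of [w^m] times [w^k] is a power
    of the conjugate of [w] with exponent [m - k], strictly between [0] and
    [S K], so each monomial of the polynomial contributes a geometric sum that
    vanishes. *)
Lemma roots_of_unity_orthogonal (c : nat -> C) (K n m : nat) :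
  (n < m <= K)%nat ->
  sum_n (fun j => Cconj (root_of_unity (S K) ^ j) ^ m
                  * poly_eval c n (root_of_unity (S K) ^ j)) K = RtoC 0.
Proof.
  intros Hnm. set (w := root_of_unity (S K)).
  assert (Hw : Cconj w * w = 1).
  { rewrite Cmult_comm, <- Cmod2_conj. unfold w. rewrite root_of_unity_Cmod.
    simpl. now rewrite !Rmult_1_l. }
  assert (Hswap : forall j, Cconj (w ^ j) ^ m * poly_eval c n (w ^ j) =
    sum_n (fun k => c k * (Cconj w ^ (m - k)) ^ j) n).
  { intros j. unfold poly_eval. rewrite <- C_sum_mult_l.
    apply sum_n_ext_loc. intros k Hk.
    replace m with ((m - k) + k)%nat at 1 by lia.
    rewrite Cpow_add_r, Cpow_conj, <- !Cpow_mult_r.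
    rewrite (Nat.mul_comm j (m - k)).
    transitivity (c k * Cconj w ^ ((m - k) * j) * (Cconj w * w) ^ (j * k)).
    - rewrite Cpow_mult_l. ring_at_C.
    - rewrite Hw, Cpow_1_l. ring_at_C. }
  rewrite (sum_n_ext _ _ K Hswap), sum_n_switch.
  transitivity (sum_n (fun _ : nat => RtoC 0) n).
  - apply sum_n_ext_loc. intros k Hk. rewrite C_sum_mult_l.
    rewrite geometric_sum_root_of_unity; [ring_at_C| |].
    + rewrite <- Cpow_mult_r, Nat.mul_comm, Cpow_mult_r, <- Cpow_conj.
      unfold w. rewrite root_of_unity_pow by lia.
      rewrite <- Cpow_conj, Cpow_1_l. unfold Cconj; simpl. now rewrite Ropp_0.
    + rewrite <- Cpow_conj. intros H.
      apply (root_of_unity_primitive (S K) (m - k)); [lia|].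
      apply (f_equal Cconj) in H. rewrite Cconj_conj in H.
      unfold w in H. rewrite H. unfold Cconj; simpl. now rewrite Ropp_0.
  - clear. induction n as [|n IH]; [apply sum_O|].
    rewrite C_sum_Sn, IH. ring_at_C.
Qed.

Lemma Cmod2_plus (p q : C) :
  (Cmod (p + q) ^ 2 = Cmod p ^ 2 + Cmod q ^ 2 + 2 * Re (Cconj q * p))%R.
Proof.
  rewrite !Cmod2_alt. destruct p as [p1 p2], q as [q1 q2]. simpl. ring.
Qed.

Lemma Re_sum (u : nat -> C) (n : nat) :
  Re (sum_n u n) = sum_n (fun k => Re (u k)) n.
Proof.
  induction n as [|n IH]; [now rewrite !sum_O|].
  rewrite C_sum_Sn, R_sum_Sn, <- IH. reflexivity.
Qed.

(** Induction on the degree: the cross term between the new leading monomial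
    and the lower part is orthogonal to it.  This needs more nodes than the
    degree, hence [n <= K] with [S K] nodes. *)
Lemma discrete_parseval (c : nat -> C) (K n : nat) :
  (n <= K)%nat ->
  sum_n (fun j => (Cmod (poly_eval c n (root_of_unity (S K) ^ j)) ^ 2)%R) K
  = (INR (S K) * sum_n (fun k => (Cmod (c k) ^ 2)%R) n)%R.
Proof.
  set (w := root_of_unity (S K)).
  assert (Hw : forall j k, Cmod ((w ^ j) ^ k) = 1%R).
  { intros j k. rewrite !Cmod_pow. unfold w.
    now rewrite root_of_unity_Cmod, !pow1. }
  assert (Hcst : forall x : R, sum_n (fun _ : nat => x) K = (INR (S K) * x)%R)
    by (intros x; apply sum_n_const).
  induction n as [|n IH]; intros Hn.
  - rewrite sum_O, <- Hcst. apply sum_n_ext. intros j.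
    unfold poly_eval. rewrite sum_O, Cmod_mult, Hw, Rmult_1_r. reflexivity.
  - rewrite R_sum_Sn, Rmult_plus_distr_l, <- IH, <- Hcst by lia.
    transitivity (sum_n (fun j => plus (plus
       (Cmod (poly_eval c n (w ^ j)) ^ 2)%R (Cmod (c (S n)) ^ 2)%R)
       (2 * Re (Cconj (c (S n)) *
          (Cconj (w ^ j) ^ S n * poly_eval c n (w ^ j))))%R) K).
    + apply sum_n_ext. intros j. unfold poly_eval at 1.
      rewrite C_sum_Sn, Cmod2_plus. fold (poly_eval c n (w ^ j)).
      rewrite Cmod_mult, Hw, Rmult_1_r, Cmult_conj, Cpow_conj, Cmult_assoc.
      reflexivity.
    + rewrite sum_n_plus, sum_n_plus.
      etransitivity; [|apply Rplus_0_r].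
      apply (f_equal2 Rplus); [reflexivity|].
      transitivity (2 * Re (Cconj (c (S n)) * 0))%R.
      * rewrite <- (roots_of_unity_orthogonal c K n (S n)) by lia. fold w.
        rewrite <- C_sum_mult_l, Re_sum. 
        exact (sum_n_mult_l (K := R_Ring) 2%R _ K).
      * rewrite Cmult_0_r. simpl. ring.
Qed.

Lemma parseval_le (c : nat -> C) (K : nat) (M : R) :
  (forall x, Cmod x = 1%R -> (Cmod (poly_eval c K x) <= M)%R) ->
  (sum_n (fun k => (Cmod (c k) ^ 2)%R) K <= M ^ 2)%R.
Proof.
  intros HM.
  assert (HK : (0 < INR (S K))%R) by (apply lt_0_INR; lia).
  apply Rmult_le_reg_l with (INR (S K)); [exact HK|].
  rewrite <- (discrete_parseval c K K) by lia.
  assert (Hcst : sum_n (fun _ : nat => (M ^ 2)%R) K = (INR (S K) * M ^ 2)%R)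
    by apply sum_n_const.
  rewrite <- Hcst. apply sum_n_m_le. intros j.
  apply pow_incr. split; [apply Cmod_ge_0|]. apply HM.
  now rewrite Cmod_pow, root_of_unity_Cmod, pow1.
Qed.

(** * The norm of a bounded function *)

Lemma bernoulli_pow (x : R) (n : nat) :
  (0 <= x <= 1)%R -> (1 - INR n * x <= (1 - x) ^ n)%R.
Proof.
  intros Hx. induction n as [|n IH].
  - simpl. lra.
  - rewrite S_INR. simpl.
    apply Rle_trans with ((1 - x) * (1 - INR n * x))%R.
    + assert (Hn := pos_INR n). nra.
    + apply Rmult_le_compat_l; lra.
Qed.

Lemma R_sum_le_mono (s : nat -> R) (n m : nat) :
  (forall k, 0 <= s k)%R -> (n <= m)%nat -> (sum_n s n <= sum_n s m)%R.
Proof.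
  intros Hs. induction 1 as [|m Hm IH]; [lra|].
  rewrite R_sum_Sn. generalize (Hs (S m)). lra.
Qed.

(** On the circle of radius [r] the partial sums of [f] converge uniformly, so
    they are bounded by [M + eps] from some degree on, and Parseval applies to
    them. *)
Lemma bounded_circle_coef_sum (u : nat -> C) (f : C -> C) (M r : R) (n : nat) :
  taylor_on_disk u f ->
  (forall z, disk z -> Cmod (f z) <= M)%R ->
  (0 <= r < 1)%R ->
  (sum_n (fun k => (Cmod (u k * RtoC r ^ k) ^ 2)%R) n <= M ^ 2)%R.
Proof.
  intros Hu HM Hr.
  assert (HM0 : (0 <= M)%R).
  { eapply Rle_trans; [apply Cmod_ge_0|apply (HM 0)].
    unfold disk. rewrite Cmod_0. lra. }
  set (A := sum_n _ n).
  assert (HA0 : (0 <= A)%R) by (apply R_sum_nonneg; intros k; apply pow2_ge_0).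
  assert (Hsqrt : (sqrt A <= M)%R).
  { apply le_epsilon. intros eps Heps.
    destruct (taylor_abs_summable u f r Hu Hr) as [t Ht].
    destruct (R_series_eps _ t Ht eps Heps) as [N HN].
    pose (K := Nat.max n N).
    assert (HK : (A <= (M + eps) ^ 2)%R).
    { eapply Rle_trans.
      - apply (R_sum_le_mono _ n K); [intros k; apply pow2_ge_0|apply Nat.le_max_l].
      - apply parseval_le. intros x Hx.
        assert (Hrx : disk (RtoC r * x)).
        { unfold disk. rewrite Cmod_mult, Hx, Cmod_R, Rabs_pos_eq; lra. }
        assert (Hmod : forall k, (Cmod (u k * (RtoC r * x) ^ k) <= Cmod (u k) * r ^ k)%R).
        { intros k. apply Req_le.
          rewrite Cmod_mult, Cmod_pow, Cmod_mult, Hx, Cmod_R, Rabs_pos_eq, Rmult_1_r;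
            lra. }
        assert (Htail := C_series_tail _ _ _ t K Hmod Ht (Hu _ Hrx)).
        replace (poly_eval (fun k => u k * RtoC r ^ k) K x)
          with (sum_n (fun k => u k * (RtoC r * x) ^ k) K).
        2:{ apply sum_n_ext. intros k. rewrite Cpow_mult_l. ring_at_C. }
        set (p := sum_n (fun k => u k * (RtoC r * x) ^ k) K) in *.
        set (y := f (RtoC r * x)) in *.
        replace (p : C) with (y + - (y - p)) by ring.
        eapply Rle_trans; [apply Cmod_triangle|]. rewrite Cmod_opp.
        assert (HNK := HN K (Nat.le_max_r _ _)). apply Rabs_def2 in HNK.
        assert (HMy := HM _ Hrx). fold y in HMy. lra. }
    apply Rsqr_incr_0_var; [|lra].
    rewrite Rsqr_sqrt by exact HA0. rewrite Rsqr_pow2. exact HK. }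
  rewrite <- (pow2_sqrt A HA0). apply pow_incr. split; [apply sqrt_pos|exact Hsqrt].
Qed.

(** Let the radius tend to [1].  For a fixed number of terms the coefficients
    lose at most the factor [r ^ (2 n)], which Bernoulli's inequality bounds
    below. *)
Lemma bounded_coef_sum (u : nat -> C) (f : C -> C) (M : R) (n : nat) :
  taylor_on_disk u f ->
  (forall z, disk z -> Cmod (f z) <= M)%R ->
  (sum_n (fun k => (Cmod (u k) ^ 2)%R) n <= M ^ 2)%R.
Proof.
  intros Hu HM. set (A := sum_n _ n).
  assert (HA0 : (0 <= A)%R) by (apply R_sum_nonneg; intros k; apply pow2_ge_0).
  assert (Hr : forall r, (0 <= r < 1)%R -> ((r ^ n) ^ 2 * A <= M ^ 2)%R).
  { intros r Hr. eapply Rle_trans; [|exact (bounded_circle_coef_sum u f M r n Hu HM Hr)].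
    replace ((r ^ n) ^ 2 * A)%R
      with (sum_n (fun k => ((r ^ n) ^ 2 * Cmod (u k) ^ 2)%R) n)
      by exact (sum_n_mult_l (K := R_Ring) ((r ^ n) ^ 2)%R _ n).
    rewrite !sum_n_Reals. apply sum_Rle. intros k Hk.
    rewrite Cmod_mult, Cmod_pow, Cmod_R, Rabs_pos_eq, Rpow_mult_distr, Rmult_comm by lra.
    apply Rmult_le_compat_l; [apply pow2_ge_0|].
    apply pow_incr. split; [apply pow_le; lra|].
    replace n with (k + (n - k))%nat by lia. rewrite pow_add.
    rewrite <- (Rmult_1_r (r ^ k)) at 2.
    apply Rmult_le_compat_l; [apply pow_le; lra|].
    rewrite <- (pow1 (n - k)). apply pow_incr. lra. }
  apply le_epsilon. intros eps Heps.
  pose (q := INR (n * 2)).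
  assert (Hq : (0 <= q)%R) by apply pos_INR.
  pose (x := Rmin 1 (eps / ((q + 1) * (A + 1)))).
  assert (HqA : (0 < (q + 1) * (A + 1))%R) by nra.
  assert (Hx : (0 < x <= 1)%R).
  { split; [|apply Rmin_l]. apply Rmin_glb_lt; [lra|].
    now apply Rdiv_lt_0_compat. }
  assert (Hxe : (x * ((q + 1) * (A + 1)) <= eps)%R).
  { apply Rle_trans with (eps / ((q + 1) * (A + 1)) * ((q + 1) * (A + 1)))%R.
    - apply Rmult_le_compat_r; [lra|apply Rmin_r].
    - apply Req_le. field. lra. }
  assert (Hb := bernoulli_pow x (n * 2) ltac:(lra)).
  rewrite pow_mult in Hb. fold q in Hb.
  assert (HrA := Hr (1 - x)%R ltac:(lra)).
  assert (Hmul := Rmult_le_compat_r A _ _ HA0 Hb).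
  assert (x * (q * A) <= x * ((q + 1) * (A + 1)))%R
    by (apply Rmult_le_compat_l; nra).
  nra.
Qed.

(** The inclusion of the bounded functions in [H^2] is a contraction. *)
Lemma bounded_H2_norm (u : nat -> C) (f : C -> C) (M : R) :
  taylor_on_disk u f ->
  (forall z, disk z -> Cmod (f z) <= M)%R ->
  exists N, is_H2_norm f N /\ (N <= M)%R.
Proof.
  intros Hu HM.
  assert (HM0 : (0 <= M)%R).
  { eapply Rle_trans; [apply Cmod_ge_0|apply (HM 0)].
    unfold disk. rewrite Cmod_0. lra. }
  pose (s := fun k => (Cmod (u k) ^ 2)%R).
  assert (Hs : forall k, (0 <= s k)%R) by (intros k; apply pow2_ge_0).
  assert (Hb : forall n, (sum_n s n <= M ^ 2)%R)
    by (intros n; exact (bounded_coef_sum u f M n Hu HM)).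
  destruct (ex_finite_lim_seq_incr (sum_n s) (M ^ 2)) as [t Ht].
  - intros n. rewrite R_sum_Sn. generalize (Hs (S n)). lra.
  - exact Hb.
  - assert (Ht0 : (0 <= t)%R).
    { eapply Rle_trans; [apply (R_sum_nonneg s 0 Hs)|].
      now apply R_partial_sum_le. }
    assert (HtM : (t <= M ^ 2)%R).
    { apply (is_lim_seq_le (sum_n s) (fun _ => (M ^ 2)%R) t (M ^ 2)%R Hb Ht).
      apply is_lim_seq_const. }
    exists (sqrt t). split.
    + split; [apply sqrt_pos|]. exists u. split; [exact Hu|].
      rewrite pow2_sqrt by exact Ht0. exact Ht.
    + apply Rsqr_incr_0_var; [|exact HM0].
      rewrite Rsqr_sqrt, Rsqr_pow2 by exact Ht0. exact HtM.
Qed.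

(** * The mean value inequality *)

Lemma is_derive_eps (g : C -> C) (z l : C) :
  is_derive g z l -> forall eps : R, (0 < eps)%R ->
  exists delta : R, (0 < delta)%R /\ forall y, (Cmod (y - z) < delta)%R ->
    (Cmod (g y - g z - (y - z) * l) <= eps * Cmod (y - z))%R.
Proof.
  intros [_ Hg] eps Heps.
  specialize (Hg z (fun P H => H) (mkposreal eps Heps)).
  apply (locally_le_locally_norm (K := C_AbsRing) (V := AbsRing_NormedModule C_AbsRing)) in Hg.
  destruct Hg as [d Hd]. exists d. split; [apply cond_pos|].
  intros y Hy. exact (Hd y Hy).
Qed.

Definition segment (x y : C) (t : R) : C := x + RtoC t * (y - x).

(** The mean value theorem fails for complex values; pairing with a fixed vector
    [v] turns [g] along a segment into a real function to which it applies. *)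
Lemma derive_along_segment (g : C -> C) (x y v l : C) (t : R) :
  is_derive g (segment x y t) l ->
  derivable_pt_lim (fun t => Re (Cconj v * g (segment x y t))) t
    (Re (Cconj v * ((y - x) * l))).
Proof.
  intros Hg eps Heps.
  set (d := y - x). set (p := segment x y t) in *.
  assert (Hv := Cmod_ge_0 v). assert (Hd := Cmod_ge_0 d).
  (* The added 1 keeps the divisor positive when [v] or [d] vanishes. *)
  pose (q := (Cmod v * Cmod d + 1)%R).
  assert (Hq : (Cmod v * Cmod d < q)%R) by (unfold q; lra).
  assert (Hq0 : (0 < q)%R) by (unfold q; nra).
  destruct (is_derive_eps g p l Hg (eps / q)) as [delta [Hdelta Hb]].
  { now apply Rdiv_lt_0_compat. }
  assert (Hdd : (0 < delta / (Cmod d + 1))%R) by (apply Rdiv_lt_0_compat; lra).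
  exists (mkposreal _ Hdd). intros h Hh Hhd. simpl in Hhd.
  assert (Hh0 : (0 < Rabs h)%R) by now apply Rabs_pos_lt.
  assert (Hstep : segment x y (t + h) - p = RtoC h * d).
  { unfold p, segment, d. rewrite RtoC_plus. ring. }
  assert (Hsmall : (Cmod (segment x y (t + h) - p) < delta)%R).
  { rewrite Hstep, Cmod_mult, Cmod_R.
    apply Rle_lt_trans with (Rabs h * (Cmod d + 1))%R.
    - apply Rmult_le_compat_l; lra.
    - apply (Rmult_lt_compat_r (Cmod d + 1)) in Hhd; [|lra].
      field_simplify in Hhd; lra. }
  specialize (Hb _ Hsmall). rewrite Hstep in Hb.
  set (e := g (segment x y (t + h)) - g p - RtoC h * d * l) in Hb.
  replace ((Re (Cconj v * g (segment x y (t + h))) - Re (Cconj v * g p)) / h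
           - Re (Cconj v * (d * l)))%R with (Re (Cconj v * e) / h)%R.
  2:{ replace (Re (Cconj v * e)) with
        (Re (Cconj v * g (segment x y (t + h))) - Re (Cconj v * g p)
         - h * Re (Cconj v * (d * l)))%R.
      - field. exact Hh.
      - unfold e. rewrite <- (Cmult_assoc (RtoC h) d l).
        generalize v (g (segment x y (t + h))) (g p) (d * l).
        intros [? ?] [? ?] [? ?] [? ?]. simpl. ring. }
  unfold Rdiv. rewrite Rabs_mult, Rabs_inv.
  apply Rmult_lt_reg_r with (Rabs h); [exact Hh0|].
  rewrite Rmult_assoc, Rinv_l, Rmult_1_r by lra.
  eapply Rle_lt_trans; [apply re_le_Cmod|].
  rewrite Cmod_mult, Cmod_conj.
  rewrite Cmod_mult, Cmod_R in Hb.
  apply (Rmult_le_compat_l (Cmod v)) in Hb; [|exact Hv].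
  eapply Rle_lt_trans; [exact Hb|].
  replace (Cmod v * (eps / q * (Rabs h * Cmod d)))%R
    with ((eps / q * Rabs h) * (Cmod v * Cmod d))%R by ring.
  replace (eps * Rabs h)%R with ((eps / q * Rabs h) * q)%R by (field; lra).
  apply Rmult_lt_compat_l; [|exact Hq].
  apply Rmult_lt_0_compat; [now apply Rdiv_lt_0_compat|exact Hh0].
Qed.

Lemma Re_conj_self (v : C) : Re (Cconj v * v) = (Cmod v ^ 2)%R.
Proof. rewrite Cmod2_alt. destruct v. simpl. ring. Qed.

(** Pairing with [v = g y - g x] itself recovers the full modulus:
    [|v|^2 = Re (conj v * v)], and dividing by [|v|] gives the inequality with
    the sharp constant. *)
Lemma mean_value_segment (g g' : C -> C) (x y : C) (B : R) :
  (forall t, (0 <= t <= 1)%R -> is_derive g (segment x y t) (g' (segment x y t))) ->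
  (forall t, (0 <= t <= 1)%R -> (Cmod (g' (segment x y t)) <= B)%R) ->
  (Cmod (g y - g x) <= B * Cmod (y - x))%R.
Proof.
  intros Hg HB. set (v := g y - g x).
  assert (H0 : segment x y 0 = x) by (unfold segment; ring).
  assert (H1 : segment x y 1 = y) by (unfold segment; ring).
  destruct (MVT_cor2 (fun t => Re (Cconj v * g (segment x y t)))
    (fun t => Re (Cconj v * ((y - x) * g' (segment x y t)))) 0 1 Rlt_0_1)
    as [c [Hc Hc01]].
  { intros c Hc. apply derive_along_segment. now apply Hg. }
  rewrite H0, H1 in Hc.
  assert (Hv2 : (Cmod v ^ 2 = Re (Cconj v * ((y - x) * g' (segment x y c))))%R).
  { rewrite <- Re_conj_self.
    replace (Re (Cconj v * v)) with (Re (Cconj v * g y) - Re (Cconj v * g x))%R.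
    - rewrite Hc. ring.
    - unfold v at 3. generalize v (g y) (g x). intros [? ?] [? ?] [? ?]. simpl. ring. }
  assert (Hle : (Cmod v ^ 2 <= Cmod v * (B * Cmod (y - x)))%R).
  { rewrite Hv2. eapply Rle_trans; [apply Rle_abs|].
    eapply Rle_trans; [apply re_le_Cmod|].
    rewrite !Cmod_mult, Cmod_conj.
    apply Rmult_le_compat_l; [apply Cmod_ge_0|].
    rewrite Rmult_comm. apply Rmult_le_compat_r; [apply Cmod_ge_0|].
    apply HB. lra. }
  destruct (Rle_lt_or_eq_dec 0 (Cmod v) (Cmod_ge_0 v)) as [Hv|Hv].
  - apply Rmult_le_reg_l with (Cmod v); [exact Hv|]. simpl in Hle. lra.
  - rewrite <- Hv. apply Rmult_le_pos; [|apply Cmod_ge_0].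
    eapply Rle_trans; [apply Cmod_ge_0|]. apply (HB 0%R). lra.
Qed.

(** * The disks [D_n] and the values of [g] near 1 *)

Lemma phi_comp (s t : R) (z : C) : phi s (phi t z) = phi (s * t) z.
Proof. unfold phi. rewrite RtoC_mult. ring. Qed.

Lemma phi_disk (s : R) (z : C) : (0 < s <= 1)%R -> disk z -> disk (phi s z).
Proof.
  unfold disk, phi. intros Hs Hz.
  replace (RtoC s * z + 1 - RtoC s) with (RtoC s * z + RtoC (1 - s))
    by (rewrite RtoC_minus; ring).
  eapply Rle_lt_trans; [apply Cmod_triangle|].
  rewrite Cmod_mult, !Cmod_R, !Rabs_pos_eq by lra. nra.
Qed.

Lemma pow_unit (a : R) (n : nat) : (0 < a < 1)%R -> (0 < a ^ n <= 1)%R.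
Proof.
  intros Ha. split; [apply pow_lt; lra|].
  rewrite <- (pow1 n). apply pow_incr. lra.
Qed.

Lemma disk_n_antitone (a : R) (n m : nat) (z : C) :
  (0 < a < 1)%R -> (n <= m)%nat -> disk_n a m z -> disk_n a n z.
Proof.
  intros Ha Hnm [w [Hw ->]]. exists (phi (a ^ (m - n)) w). split.
  - apply phi_disk; [now apply pow_unit|exact Hw].
  - rewrite phi_comp, <- pow_add. do 2 f_equal. lia.
Qed.

Lemma disk_n_segment (a : R) (n : nat) (z w : C) (t : R) :
  disk_n a n z -> disk_n a n w -> (0 <= t <= 1)%R -> disk_n a n (segment z w t).
Proof.
  intros [z' [Hz ->]] [w' [Hw ->]] Ht. exists (segment z' w' t). split.
  - unfold disk, segment in *.
    replace (z' + RtoC t * (w' - z')) with (RtoC (1 - t) * z' + RtoC t * w')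
      by (rewrite RtoC_minus; ring).
    eapply Rle_lt_trans; [apply Cmod_triangle|].
    rewrite !Cmod_mult, !Cmod_R, !Rabs_pos_eq by lra.
    apply Rle_lt_trans with (Rmax (Cmod z') (Cmod w')).
    + assert (H1 := Rmax_l (Cmod z') (Cmod w')).
      assert (H2 := Rmax_r (Cmod z') (Cmod w')). nra.
    + now apply Rmax_lub_lt.
  - unfold phi, segment. ring.
Qed.

Lemma disk_0 : disk 0.
Proof. unfold disk. rewrite Cmod_0. lra. Qed.

Lemma iter_comp_op (a : R) (g : C -> C) (n : nat) (z : C) :
  Nat.iter n (comp_op a) g z = g (phi (a ^ n) z).
Proof.
  revert z. induction n as [|n IH]; intros z.
  - simpl. f_equal. unfold phi. ring.
  - simpl Nat.iter. unfold comp_op at 1. rewrite IH, phi_comp.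
    do 2 f_equal. simpl. ring.
Qed.

Lemma phi_0 (s : R) : phi s 0 = RtoC (1 - s).
Proof. unfold phi. rewrite RtoC_minus. ring. Qed.

(** Both points lie in the convex disk [D_m], included in the disk where [g'] is
    bounded, and their distance is [a^m |z|]. *)
Lemma eventually_bounded_derivative_lipschitz (a : R) (g g' : C -> C) :
  (0 < a < 1)%R ->
  (forall z, disk z -> is_derive g z (g' z)) ->
  eventually_bounded a g' ->
  exists n B, (0 <= B)%R /\ forall m z, (n <= m)%nat -> disk z ->
    (Cmod (g (phi (a ^ m) z) - g (RtoC (1 - a ^ m))) <= B * a ^ m)%R.
Proof.
  intros Ha Hg [_ [n [B HB]]].
  assert (HB0 : (0 <= B)%R).
  { eapply Rle_trans; [apply Cmod_ge_0|apply HB].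
    exists 0. split; [apply disk_0|reflexivity]. }
  exists n, B. split; [exact HB0|]. intros m z Hm Hz.
  assert (Hin : forall w, disk w -> disk_n a n (phi (a ^ m) w)).
  { intros w Hw. apply (disk_n_antitone a n m); trivial. now exists w. }
  assert (Hdisk : forall w, disk_n a n w -> disk w).
  { intros w [w' [Hw' ->]]. apply phi_disk; [now apply pow_unit|exact Hw']. }
  rewrite <- phi_0.
  assert (Hseg : forall t, (0 <= t <= 1)%R ->
    disk_n a n (segment (phi (a ^ m) 0) (phi (a ^ m) z) t)).
  { intros t Ht. apply disk_n_segment; trivial; apply Hin; trivial. apply disk_0. }
  eapply Rle_trans.
  - apply (mean_value_segment g g' _ _ B).
    + intros t Ht. now apply Hg, Hdisk, Hseg.
    + intros t Ht. now apply HB, Hseg.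
  - apply Rmult_le_compat_l; [exact HB0|].
    replace (phi (a ^ m) z - phi (a ^ m) 0) with (RtoC (a ^ m) * z)
      by (unfold phi; ring).
    assert (Hp := pow_unit a m Ha).
    rewrite Cmod_mult, Cmod_R, Rabs_pos_eq by lra.
    unfold disk in Hz. assert (Hz0 := Cmod_ge_0 z). nra.
Qed.

Lemma pow_small (a B eps : R) (n : nat) :
  (0 < a < 1)%R -> (0 <= B)%R -> (0 < eps)%R ->
  exists m, (n <= m)%nat /\ (B * a ^ m < eps)%R.
Proof.
  intros Ha HB Heps.
  destruct (pow_lt_1_zero a ltac:(rewrite Rabs_pos_eq; lra) (eps / (B + 1)))
    as [N HN]; [apply Rdiv_lt_0_compat; lra|].
  exists (Nat.max n N). split; [apply Nat.le_max_l|].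
  specialize (HN _ (Nat.le_max_r n N)). rewrite Rabs_pos_eq in HN by (apply pow_le; lra).
  assert (Hp := pow_unit a (Nat.max n N) Ha).
  apply (Rmult_lt_compat_l (B + 1)) in HN; [|lra].
  replace ((B + 1) * (eps / (B + 1)))%R with eps in HN by (field; lra). lra.
Qed.

(** For [p >= m] the point [1 - a^p] is the image under [phi_(a^m)] of a point
    of the disk, so all later values lie within [B a^m] of [g (1 - a^m)]. *)
Lemma boundary_values_converge (a : R) (g g' : C -> C) :
  (0 < a < 1)%R ->
  (forall z, disk z -> is_derive g z (g' z)) ->
  eventually_bounded a g' ->
  exists L, seq_converges_to (fun n => g (RtoC (1 - a ^ n))) L.
Proof.
  intros Ha Hg HEB.
  destruct (eventually_bounded_derivative_lipschitz a g g' Ha Hg HEB)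
    as [n [B [HB Hlip]]].
  assert (Hosc : forall m p, (n <= m)%nat -> (m <= p)%nat ->
    (Cmod (g (RtoC (1 - a ^ p)) - g (RtoC (1 - a ^ m))) <= B * a ^ m)%R).
  { intros m p Hm Hp.
    replace (g (RtoC (1 - a ^ p))) with (g (phi (a ^ m) (phi (a ^ (p - m)) 0))).
    - apply Hlip; [exact Hm|]. apply phi_disk; [now apply pow_unit|apply disk_0].
    - rewrite phi_comp, phi_0, <- pow_add. do 5 f_equal. lia. }
  apply (proj1 (filterlim_locally_cauchy (U := C_CompleteNormedModule)
    (F := eventually) (fun n => g (RtoC (1 - a ^ n))))).
  intros eps.
  destruct (pow_small a (B + B) eps n Ha ltac:(lra) (cond_pos eps)) as [m [Hm Hsmall]].
  exists (fun p => (m <= p)%nat). split; [now exists m|].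
  intros p q Hp Hq.
  apply C_NormedModule_mixin_compat1.
  change (Cmod (g (RtoC (1 - a ^ q)) - g (RtoC (1 - a ^ p))) < eps)%R.
  set (x := g (RtoC (1 - a ^ m))).
  replace (g (RtoC (1 - a ^ q)) - g (RtoC (1 - a ^ p)))
    with ((g (RtoC (1 - a ^ q)) - x) + - (g (RtoC (1 - a ^ p)) - x)) by ring.
  eapply Rle_lt_trans; [apply Cmod_triangle|]. rewrite Cmod_opp.
  assert (H1 := Hosc m p Hm Hp). assert (H2 := Hosc m q Hm Hq).
  fold x in H1, H2. lra.
Qed.

(** * The orbit space contains the constants *)

Lemma taylor_ext (u : nat -> C) (f h : C -> C) :
  eq_on_disk f h -> taylor_on_disk u f -> taylor_on_disk u h.
Proof. intros Hfh Hu z Hz. rewrite <- (Hfh z Hz). now apply Hu. Qed.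

Lemma H2_norm_ext (f h : C -> C) (N : R) :
  eq_on_disk f h -> is_H2_norm f N -> is_H2_norm h N.
Proof.
  intros Hfh [HN [u [Hu Hs]]]. split; [exact HN|].
  exists u. split; [now apply (taylor_ext u f)|exact Hs].
Qed.

Lemma taylor_const (c : C) :
  taylor_on_disk (fun n => match n with O => c | S _ => 0 end) (fun _ => c).
Proof.
  intros z _. apply C_limit_eps. intros eps Heps. exists 0%nat. intros n _.
  replace (sum_n _ n : C) with c.
  - replace (c - c) with (RtoC 0) by ring. now rewrite Cmod_0.
  - induction n as [|n IH].
    + rewrite sum_O. simpl. ring.
    + rewrite C_sum_Sn, <- IH. ring.
Qed.

Lemma taylor_scal_minus (u v : nat -> C) (f h : C -> C) (c : C) :
  taylor_on_disk u f -> taylor_on_disk v h ->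
  taylor_on_disk (fun n => u n - c * v n) (fun z => f z - c * h z).
Proof.
  intros Hu Hv z Hz.
  eapply is_series_ext;
    [|exact (is_series_minus _ _ _ _ (Hu z Hz) (is_series_scal_l c _ _ (Hv z Hz)))].
  intros n. change (u n * z ^ n + - (c * (v n * z ^ n)) = (u n - c * v n) * z ^ n).
  ring.
Qed.

Lemma H2_const (c : C) : H2 (fun _ => c).
Proof.
  destruct (bounded_H2_norm _ (fun _ => c) (Cmod c) (taylor_const c)) as [N [HN _]].
  - intros z _. lra.
  - now exists N.
Qed.

Lemma H2_ext (f h : C -> C) : eq_on_disk f h -> H2 f -> H2 h.
Proof. intros Hfh [N HN]. exists N. now apply (H2_norm_ext f). Qed.

Lemma span_single (e : nat -> C -> C) (n : nat) (c : C) :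
  span e (fun z => c * e n z).
Proof.
  exists (S n), (fun k => if Nat.eqb k n then c else 0).
  intros z _. simpl. rewrite Nat.eqb_refl.
  replace (lin_comb (fun k => if Nat.eqb k n then c else 0) e n z) with (RtoC 0);
    [ring|].
  assert (H : forall d, (d <= n)%nat ->
    lin_comb (fun k => if Nat.eqb k n then c else 0) e d z = 0).
  { induction d as [|d IH]; intros Hd; [reflexivity|].
    simpl. rewrite IH by lia.
    replace (Nat.eqb d n) with false by (symmetry; apply Nat.eqb_neq; lia). ring. }
  now rewrite H.
Qed.

(** The multiple [(c / L) g o phi_(a^m)] of a single iterate approximates the
    constant [c]: it is uniformly close to it, hence close in norm. *)
Lemma constants_in_orbit_space (a : R) (g g' : C -> C) (L : C) :
  (0 < a < 1)%R -> H2 g ->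
  (forall z, disk z -> is_derive g z (g' z)) ->
  eventually_bounded a g' ->
  seq_converges_to (fun n => g (RtoC (1 - a ^ n))) L -> L <> 0 ->
  forall f c, eq_on_disk f (fun _ => c) -> orbit_space a g f.
Proof.
  intros Ha [Ng [_ [u [Hu _]]]] Hg HEB HL HL0 f c Hf. split.
  - apply (H2_ext (fun _ => c)); [|apply H2_const].
    intros z Hz. now rewrite (Hf z Hz).
  - intros eps Heps.
    destruct (eventually_bounded_derivative_lipschitz a g g' Ha Hg HEB)
      as [n [B [HB Hlip]]].
    pose (k := c / L). assert (Hk := Cmod_ge_0 k).
    (* Half of [eps] gives a strict bound in the end, and it is shared between
       [|g (phi_(a^m) z) - g (1 - a^m)|] and [|g (1 - a^m) - L|]; [q] absorbs
       the factor [|k|]. *)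
    pose (q := (Cmod k + 1)%R).
    destruct (proj1 (C_limit_eps _ _) HL (eps / 4 / q)%R) as [N HN].
    { unfold q. repeat apply Rdiv_lt_0_compat; lra. }
    destruct (pow_small a B (eps / 4 / q)%R (Nat.max n N) Ha HB) as [m [Hm Hsmall]].
    { unfold q. repeat apply Rdiv_lt_0_compat; lra. }
    exists (fun z => k * Nat.iter m (comp_op a) g z). split.
    { apply span_single with (e := fun n => Nat.iter n (comp_op a) g). }
    assert (Hp := pow_unit a m Ha).
    destruct (taylor_affine_comp u g (a ^ m) (1 - a ^ m) Hu) as [v Hv]; try lra.
    assert (Hphi : forall z, RtoC (a ^ m) * z + RtoC (1 - a ^ m) = phi (a ^ m) z).
    { intros z. unfold phi. rewrite RtoC_minus. ring. }
    assert (Heq : eq_on_disk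
      (fun z => c - k * g (RtoC (a ^ m) * z + RtoC (1 - a ^ m)))
      (fun z => f z - k * Nat.iter m (comp_op a) g z)).
    { intros z Hz. now rewrite iter_comp_op, Hphi, (Hf z Hz). }
    destruct (bounded_H2_norm _ _ (eps / 2) (taylor_scal_minus _ _ _ _ k (taylor_const c) Hv))
      as [M [HM HMle]].
    + intros z Hz. rewrite Hphi.
      set (y := g (phi (a ^ m) z)). set (x := g (RtoC (1 - a ^ m))).
      replace (c - k * y) with (- (k * ((y - x) + (x - L))))
        by (unfold k; field; exact HL0).
      rewrite Cmod_opp, Cmod_mult.
      assert (H1 := Hlip m z ltac:(lia) Hz). fold x y in H1.
      assert (H2 := HN m ltac:(lia)). fold x in H2.
      assert (H3 : (Cmod (y - x + (x - L)) <= eps / 2 / q)%R).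
      { eapply Rle_trans; [apply Cmod_triangle|].
        replace (eps / 2 / q)%R with (eps / 4 / q + eps / 4 / q)%R
          by (unfold q; field; lra). lra. }
      apply Rle_trans with (q * (eps / 2 / q))%R.
      * apply Rmult_le_compat; trivial; [apply Cmod_ge_0|unfold q; lra].
      * apply Req_le. unfold q. field. lra.
    + exists M. split; [now apply (H2_norm_ext _ _ _ Heq)|lra].
Qed.

(** * The constants as a minimal invariant subspace *)

Definition constant_on_disk (f : C -> C) : Prop :=
  exists c : C, eq_on_disk f (fun _ => c).

Lemma taylor_pointwise_bound (u : nat -> C) (f : C -> C) (eps : R) (z : C) :
  taylor_on_disk u f -> (forall n, Cmod (u n) <= eps)%R -> disk z ->
  (Cmod (f z) * (1 - Cmod z) <= eps)%R.
Proof.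
  intros Hu Heps Hz. assert (Hz0 := Cmod_ge_0 z). unfold disk in Hz.
  assert (Hgeom := is_series_scal_l (K := R_AbsRing) (V := R_NormedModule) eps _ _
    (is_series_geom (Cmod z) ltac:(rewrite Rabs_pos_eq; lra))).
  assert (He0 : (0 <= eps)%R).
  { eapply Rle_trans; [apply Cmod_ge_0|exact (Heps 0%nat)]. }
  assert (Hb : (Cmod (f z - 0) <= eps * / (1 - Cmod z))%R).
  { apply (C_limit_le _ _ _ _ 0 (Hu z Hz)). intros n _.
    unfold Cminus. rewrite Copp_0, Cplus_0_r.
    eapply Rle_trans; [apply Cmod_sum_le|].
    eapply Rle_trans; [|refine (R_partial_sum_le _ _ n _ Hgeom)].
    2:{ intros k. apply (Rmult_le_pos eps); [exact He0|apply pow_le, Hz0]. }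
    apply sum_n_m_le. intros k. rewrite Cmod_mult, Cmod_pow.
    apply Rmult_le_compat_r; [apply pow_le, Hz0|apply Heps]. }
  replace (f z - 0) with (f z) in Hb by ring.
  apply (Rmult_le_compat_r (1 - Cmod z)) in Hb; [|lra].
  rewrite Rmult_assoc, Rinv_l, Rmult_1_r in Hb by lra. exact Hb.
Qed.

(** Evaluation at a point of the disk is continuous for the [H^2] norm.  The
    constant [1 / (1 - |z|)], weaker than the one given by the reproducing
    kernel, only uses that each coefficient is at most the norm. *)
Lemma H2_norm_pointwise_bound (f : C -> C) (N : R) (z : C) :
  is_H2_norm f N -> disk z -> (Cmod (f z) * (1 - Cmod z) <= N)%R.
Proof.
  intros [HN [u [Hu Hs]]] Hz. apply (taylor_pointwise_bound u); trivial.
  intros n.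
  assert (Hpos : forall k, (0 <= Cmod (u k) ^ 2)%R) by (intros k; apply pow2_ge_0).
  apply Rsqr_incr_0_var; [|exact HN]. rewrite !Rsqr_pow2.
  eapply Rle_trans; [|exact (R_partial_sum_le _ _ n Hpos Hs)].
  destruct n as [|n].
  - rewrite sum_O. lra.
  - rewrite R_sum_Sn. generalize (R_sum_nonneg _ n Hpos). lra.
Qed.

(** Closedness comes from the continuity of evaluations: [f z - f 0] is
    estimated through a constant close to [f] in norm, which avoids comparing
    the Taylor coefficients of [f] with those of the approximants. *)
Lemma constants_closed_subspace : closed_subspace constant_on_disk.
Proof.
  split.
  - intros f [c Hc]. apply (H2_ext (fun _ => c)); [|apply H2_const].
    intros z Hz. now rewrite (Hc z Hz).
  - now exists 0.
  - intros f h [c Hc] [d Hd]. exists (c + d). intros z Hz.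
    now rewrite (Hc z Hz), (Hd z Hz).
  - intros k f [c Hc]. exists (k * c). intros z Hz. now rewrite (Hc z Hz).
  - intros f [_ Hcl]. exists (f 0). intros z Hz.
    assert (Hzero : Cmod (f z - f 0) = 0%R).
    { apply Rle_antisym; [|apply Cmod_ge_0]. apply Rnot_lt_le. intros Hpos.
      assert (Hz0 := Cmod_ge_0 z). assert (Hz1 := Hz). unfold disk in Hz1.
      pose (eps := (Cmod (f z - f 0) * (1 - Cmod z) / 4)%R).
      assert (Heps : (0 < eps)%R).
      { apply Rdiv_lt_0_compat; [apply Rmult_lt_0_compat; lra|lra]. }
      destruct (Hcl eps Heps) as [h [[c Hc] [N [HN HNe]]]].
      assert (H1 := H2_norm_pointwise_bound _ _ z HN Hz).
      assert (H2 := H2_norm_pointwise_bound _ _ 0 HN disk_0).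
      cbv beta in H1, H2. rewrite (Hc z Hz) in H1. rewrite (Hc 0 disk_0) in H2.
      rewrite Cmod_0 in H2.
      assert (H3 : (Cmod (f z - f 0) <= Cmod (f z - c) + Cmod (f 0 - c))%R).
      { rewrite <- (Cmod_opp (f 0 - c)).
        replace (f z - f 0) with ((f z - c) + - (f 0 - c)) by ring.
        apply Cmod_triangle. }
      assert (H4 := Cmod_ge_0 (f 0 - c)).
      apply (Rmult_le_compat_r (1 - Cmod z)) in H3; [|lra].
      unfold eps in *. nra. }
    apply Cmod_eq_0 in Hzero.
    replace (f z) with (f z - f 0 + f 0) by ring. rewrite Hzero. ring.
Qed.

Lemma constants_invariant (a : R) :
  (0 < a < 1)%R -> invariant a constant_on_disk.
Proof.
  intros Ha f [c Hc]. exists c. intros z Hz. unfold comp_op.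
  apply Hc, phi_disk; [lra|exact Hz].
Qed.

(** Functions that agree on the disk are at distance 0. *)
Lemma closed_subspace_ext (M : (C -> C) -> Prop) (f h : C -> C) :
  closed_subspace M -> eq_on_disk f h -> M f -> M h.
Proof.
  intros HM Hfh Hf. apply (csub_closed M HM).
  split; [exact (H2_ext f h Hfh (csub_H2 M HM f Hf))|].
  intros eps Heps. exists f. split; [exact Hf|].
  destruct (bounded_H2_norm _ (fun _ => 0) 0 (taylor_const 0)) as [N [HN HN0]].
  - intros z _. rewrite Cmod_0. lra.
  - exists N. split; [|lra]. apply (H2_norm_ext (fun _ => 0)); [|exact HN].
    intros z Hz. rewrite (Hfh z Hz). ring.
Qed.

Lemma constants_minimal (a : R) :
  (0 < a < 1)%R -> minimal_invariant_subspace a constant_on_disk.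
Proof.
  intros Ha. split; [exact constants_closed_subspace|].
  split; [now apply constants_invariant|]. split.
  - exists (fun _ => 1). split; [now exists 1|].
    intros H. specialize (H 0 disk_0). unfold zero_fun in H.
    now apply C1_nz in H.
  - intros N HN _ HNc.
    destruct (classic (forall f, N f -> eq_on_disk f zero_fun)) as [H0|H0];
      [now left|right].
    apply not_all_ex_not in H0. destruct H0 as [f H0].
    apply imply_to_and in H0. destruct H0 as [Hf Hf0].
    destruct (HNc f Hf) as [c Hc].
    assert (Hc0 : c <> 0).
    { intros ->. apply Hf0. exact Hc. }
    intros h [d Hd].
    apply (closed_subspace_ext N (fun z => d / c * f z) h HN).
    + intros z Hz. rewrite (Hc z Hz), (Hd z Hz). field. exact Hc0.
    + now apply (csub_scal N HN).
Qed.

Lemma dim_one_of_constants (M : (C -> C) -> Prop) :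
  M (fun _ => 1) -> (has_dim M 1 <-> (forall f, M f -> constant_on_disk f)).
Proof.
  intros H1. split.
  - intros [e [_ [_ Hspan]]].
    destruct (Hspan _ H1) as [c1 Hc1].
    assert (He : forall z, disk z -> e 0%nat z = / c1 0%nat).
    { intros z Hz. specialize (Hc1 z Hz). simpl in Hc1.
      rewrite Cplus_0_l in Hc1.
      assert (Hnz : c1 0%nat <> 0).
      { intros H. rewrite H, Cmult_0_l in Hc1. now apply C1_nz. }
      replace (e 0%nat z) with (/ c1 0%nat * (c1 0%nat * e 0%nat z))
        by (field; exact Hnz).
      rewrite <- Hc1. ring. }
    intros f Hf. destruct (Hspan f Hf) as [c Hc].
    exists (c 0%nat * / c1 0%nat). intros z Hz.
    rewrite (Hc z Hz). simpl. rewrite (He z Hz). ring.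
  - intros Hconst. exists (fun _ _ => 1). split; [now intros|]. split.
    + intros c Hc i Hi. specialize (Hc 0 disk_0). simpl in Hc.
      replace i with 0%nat by lia. unfold zero_fun in Hc. rewrite <- Hc. ring.
    + intros f Hf. destruct (Hconst f Hf) as [c Hc]. exists (fun _ => c).
      intros z Hz. rewrite (Hc z Hz). simpl. ring.
Qed.

Lemma minimal_invariant_subspace_equiv (a : R) (M N : (C -> C) -> Prop) :
  (forall f, M f <-> N f) ->
  minimal_invariant_subspace a M -> minimal_invariant_subspace a N.
Proof.
  intros H HM. replace N with M; [exact HM|].
  apply functional_extensionality. intros f. now apply propositional_extensionality.
Qed.

Theorem theorem15 (a : R) (ha : (0 < a < 1)%R)
  (g g' : C -> C) (hg : H2 g)
  (hg' : forall z, disk z -> is_derive g z (g' z))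
  (hEB : eventually_bounded a g')
  (hAC :
    (exists L : C, L <> 0 /\
       seq_converges_to (fun n => g (RtoC (1 - a ^ n))) L) \/
    ~ (exists L : C,
         seq_converges_to (fun n => g (RtoC (1 - a ^ n))) L)) :
  minimal_invariant_subspace a (orbit_space a g) <->
  has_dim (orbit_space a g) 1.
Proof.
  destruct hAC as [[L [HL0 HL]]|Hno].
  2:{ destruct Hno. now apply (boundary_values_converge a g g'). }
  assert (Hsub : forall f, constant_on_disk f -> orbit_space a g f).
  { intros f [c Hc].
    now apply (constants_in_orbit_space a g g' L ha hg hg' hEB HL HL0 f c). }
  rewrite dim_one_of_constants by (apply Hsub; now exists 1).
  split.
  - intros [_ [_ [_ Hmin]]].
    destruct (Hmin constant_on_disk constants_closed_subspace
      (constants_invariant a ha) Hsub) as [H|H]; [|exact H].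
    exfalso. apply C1_nz. refine (H (fun _ => 1) _ 0 disk_0). now exists 1.
  - intros Hconst.
    apply (minimal_invariant_subspace_equiv a constant_on_disk).
    + intros f. split; [apply Hsub|apply Hconst].
    + now apply constants_minimal.
Qed.
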